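(* There exists a constant $C>0$ such that for every $p\in[0,1]$, with high probability (i.e. with probability tending to $1$ as $n\to\infty$) the random graph $G(n,p)$ admits a complete $(\omega,\alpha)$-separator of size at most $C n^{7}$, where $\omega$ and $\alpha$ are the clique number and the independence number of $G(n,p)$.
   Context: $G(n,p)$ is the Erdős–Rényi random graph on vertex set $\{1,\dots,n\}$ where each pair $ij$ is an edge independently with probability $p$. Its clique number $\omega$ is defined as the value satisfying $\mathbb{E}(\text{number of cliques of size }\omega)=1$, and its independence number $\alpha$ is defined similarly with stable sets. A cut of a graph with vertex set $V$ is a pair $(U,V\setminus U)$; it separates two sets $A,B\subseteq V$ if $A\subseteq U$ and $B\subseteq V\setminus U$. A family $\mathcal F$ of cuts of a graph on $n$ vertices is a complete $(a,b)$-separator if for every pair $(A,B)$ of disjoint vertex subsets with $|A|\le a$ and $|B|\le b$, some cut in $\mathcal F$ separates $A$ and $B$. *)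

(* Defs.v *)
From HB Require Import structures.
From mathcomp Require Import all_boot all_order all_algebra.
From mathcomp Require Import all_classical all_reals all_analysis.
From mathcomp Require Import ring.

Set Implicit Arguments.
Unset Strict Implicit.
Unset Printing Implicit Defensive.

Import Order.TTheory GRing.Theory Num.Theory.
Import numFieldNormedType.Exports.

Local Open Scope ring_scope.

Definition vpair (n : nat) := {e : {set 'I_n} | #|e| == 2}.

Definition graph (n : nat) := {set vpair n}.

Definition clique (n : nat) (G : graph n) (A : {set 'I_n}) : bool :=
  [forall e : vpair n, (val e \subset A) ==> (e \in G)].

Definition stable (n : nat) (G : graph n) (A : {set 'I_n}) : bool :=
  [forall e : vpair n, (val e \subset A) ==> (e \notin G)].

(* The probability space G(n,p): since the edges are independent, the mass of
   a graph is the product over all pairs of vertices. *)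
Definition gnp_mass (R : realType) (n : nat) (p : R) (G : graph n) : R :=
  \prod_(e : vpair n) (if e \in G then p else 1 - p).

Definition gnp_prob (R : realType) (n : nat) (p : R) (P : pred (graph n)) : R :=
  \sum_(G : graph n | P G) gnp_mass p G.

Definition gnp_expect (R : realType) (n : nat) (p : R) (X : graph n -> R) : R :=
  \sum_(G : graph n) gnp_mass p G * X G.

Definition num_cliques (n k : nat) (G : graph n) : nat :=
  #|[set A : {set 'I_n} | (#|A| == k) && clique G A]|.

Definition num_stables (n k : nat) (G : graph n) : nat :=
  #|[set A : {set 'I_n} | (#|A| == k) && stable G A]|.

(* The numbers omega and alpha solve "expected number = 1" and are in general
   not integers, so the expectation has to be extended to real sizes.  This is
   done with the Euler binomial coefficient
     Gamma(n+1) / (Gamma(x+1) Gamma(n-x+1)) = 1 / ((n+1) B(x+1, n-x+1)),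
   for 0 <= x <= n, where B is the beta integral. *)
Definition rbinom (R : realType) (n : nat) (x : R) : R :=
  (n.+1%:R * \int[@lebesgue_measure R]_(t in `[0, 1])
               (t `^ x * (1 - t) `^ (n%:R - x)))^-1.

(* The expected number of x-subsets of the n vertices all of whose pairs have
   a property that holds for each pair independently with probability q; see
   expected_cliques and expected_stables below for integral x. *)
Definition expected_homogeneous (R : realType) (n : nat) (q x : R) : R :=
  rbinom n x * q `^ (x * (x - 1) / 2).

(* x = 0 is excluded: the empty set is the only clique of size 0, so x = 0
   solves the equation for every q.  For n >= 1 and 0 < q <= 1 there is exactly
   one solution in ]0, n].  For q = 0 and n >= 2 there is none, as the
   expectation jumps from n at x = 1 to 0 for x > 1; the default value is then
   the place 1 of the jump. *)
Definition threshold_size (R : realType) (n : nat) (q : R) : R :=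
  xget 1 [set x : R | 0 < x <= n%:R /\ expected_homogeneous n q x = 1]%classic.

Definition clique_number (R : realType) (n : nat) (p : R) : R :=
  threshold_size n p.

Definition independence_number (R : realType) (n : nat) (p : R) : R :=
  threshold_size n (1 - p).

(* The cut (U, V \ U) is represented by U. *)
Definition cut (n : nat) := {set 'I_n}.

Definition separates (n : nat) (U : cut n) (A B : {set 'I_n}) : bool :=
  (A \subset U) && (B \subset ~: U).

(* Which families of cuts are complete separators of G depends only on its
   vertex set. *)
Definition complete_separator (R : realType) (n : nat) (G : graph n) (a b : R)
    (F : {set cut n}) : bool :=
  [forall A : {set 'I_n}, [forall B : {set 'I_n},
    [&& [disjoint A & B], #|A|%:R <= a & #|B|%:R <= b] ==>
      [exists U in F, separates U A B]]].

Definition admits_complete_separator (R : realType) (n : nat) (a b s : R)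
    (G : graph n) : bool :=
  [exists F : {set cut n}, complete_separator G a b F && (#|F|%:R <= s)].

Lemma rbinom_nat (R : realType) (n k : nat) : (k <= n)%N ->
  rbinom n k%:R = 'C(n, k)%:R :> R.
Proof.
move=> kn; rewrite /rbinom.
have -> : \int[@lebesgue_measure R]_(t in `[0, 1])
    (t `^ k%:R * (1 - t) `^ (n%:R - k%:R)) = beta_fun k.+1 (n - k).+1 :> R.
  rewrite /beta_fun -Rintegral_mkcond; apply: eq_Rintegral => t.
  rewrite inE/= in_itv/= => /andP[t0 t1].
  by rewrite -natrB// !powR_mulrn// subr_ge0.
rewrite beta_fun_fact subnKC// factS.
have -> : n`! = ('C(n, k) * (k`! * (n - k)`!))%N by rewrite bin_fact.
rewrite !natrM; field.
by rewrite nat1r !pnatr_eq0 -!lt0n !fact_gt0 bin_gt0 kn.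
Qed.

Lemma card_vpair_in (n : nat) (A : {set 'I_n}) :
  #|[set e : vpair n | val e \subset A]| = 'C(#|A|, 2).
Proof.
rewrite -cards_draws -(card_imset _ val_inj); apply: eq_card => B.
rewrite inE; apply/imsetP/andP => [[e]|[BA B2]].
  by rewrite inE => eA ->; split=> //; exact: (valP e).
by exists (exist _ B B2 : vpair n); rewrite ?inE.
Qed.

Lemma gnp_prob_clique (R : realType) (n : nat) (p : R) (A : {set 'I_n}) :
  gnp_prob p (fun G : graph n => clique G A) = p ^+ 'C(#|A|, 2).
Proof.
transitivity (\prod_(e : vpair n) (p + if val e \subset A then 0 else 1 - p)).
  rewrite [RHS]bigA_distr /gnp_prob big_mkcond; apply: eq_bigr => G _.
  case: ifPn => [/forallP GA|]; rewrite /gnp_mass.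
    apply: eq_bigr => e _; case: ifPn => // eG.
    by case: ifPn => // eA; move/implyP: (GA e) => /(_ eA); rewrite (negPf eG).
  rewrite negb_forall => /existsP[e]; rewrite negb_imply => /andP[eA eG].
  by rewrite (bigD1 e)//= (negPf eG) eA mul0r.
rewrite -card_vpair_in -prodr_const [RHS]big_mkcond; apply: eq_bigr => e _.
by rewrite inE; case: ifPn => _; rewrite ?addr0// addrC subrK.
Qed.

Lemma gnp_prob_stable (R : realType) (n : nat) (p : R) (A : {set 'I_n}) :
  gnp_prob p (fun G : graph n => stable G A) = (1 - p) ^+ 'C(#|A|, 2).
Proof.
transitivity (\prod_(e : vpair n) ((if val e \subset A then 0 else p) + (1 - p))).
  rewrite [RHS]bigA_distr /gnp_prob big_mkcond; apply: eq_bigr => G _.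
  case: ifPn => [/forallP GA|]; rewrite /gnp_mass.
    apply: eq_bigr => e _; case: ifPn => // eG.
    by case: ifPn => // eA; move/implyP: (GA e) => /(_ eA); rewrite eG.
  rewrite negb_forall => /existsP[e]; rewrite negb_imply negbK => /andP[eA eG].
  by rewrite (bigD1 e)//= eG eA mul0r.
rewrite -card_vpair_in -prodr_const [RHS]big_mkcond; apply: eq_bigr => e _.
by rewrite inE; case: ifPn => _; rewrite ?add0r// addrC subrK.
Qed.

Lemma expect_count (R : realType) (n k : nat) (p q : R)
    (P : graph n -> {set 'I_n} -> bool) : (k <= n)%N -> 0 <= q ->
  (forall A, gnp_prob p (fun G => P G A) = q ^+ 'C(#|A|, 2)) ->
  gnp_expect p (fun G => #|[set A : {set 'I_n} | (#|A| == k) && P G A]|%:R) =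
  expected_homogeneous n q k%:R.
Proof.
move=> kn q0 Pq; rewrite /expected_homogeneous rbinom_nat//.
have -> : k%:R * (k%:R - 1) / 2 = 'C(k, 2)%:R :> R.
  elim: k {kn} => [|k IH]; first by rewrite mul0r mul0r.
  by rewrite binS bin1 natrD -IH -natr1; field.
rewrite powR_mulrn//.
transitivity (\sum_(A : {set 'I_n} | #|A| == k) q ^+ 'C(#|A|, 2)).
  under [RHS]eq_bigr do rewrite -Pq /gnp_prob big_mkcond.
  rewrite exchange_big; apply: eq_bigr => G _ /=.
  rewrite -big_mkcondr sumr_const -[RHS]mulr_natr; congr (_ * _%:R).
  by apply: eq_card => A; rewrite inE.
rewrite (eq_bigr (fun=> q ^+ 'C(k, 2))) => [|A /eqP -> //].
rewrite sumr_const -[LHS]mulr_natl; congr (_%:R * _).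
by rewrite -[in RHS](card_ord n) -card_draws cardsE.
Qed.

Lemma expected_cliques (R : realType) (n k : nat) (p : R) :
  (k <= n)%N -> 0 <= p ->
  gnp_expect p (fun G : graph n => (num_cliques k G)%:R) =
  expected_homogeneous n p k%:R.
Proof. by move=> kn p0; apply: expect_count => // A; exact: gnp_prob_clique. Qed.

Lemma expected_stables (R : realType) (n k : nat) (p : R) :
  (k <= n)%N -> p <= 1 ->
  gnp_expect p (fun G : graph n => (num_stables k G)%:R) =
  expected_homogeneous n (1 - p) k%:R.
Proof.
move=> kn p1; apply: expect_count => [//||A]; first by rewrite subr_ge0.
exact: gnp_prob_stable.
Qed.

(* Main.v *)
(* Whether a family of cuts is a complete separator does not depend on the
   edges, so it is enough to build one of size O(n^5), with a constant
   depending on p, for every n; the extra factor n^2 absorbs that constant.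

   Let 0 < p < 1, and choose a cut at random, putting every vertex in U with
   probability p.  It separates disjoint sets A, B with probability
   p^|A| (1-p)^|B|, which for |A| <= omega and |B| <= alpha is at least
   p^omega (1-p)^alpha.  Since rbinom n x <= 8 (4n)^x, the equation
   rbinom n x * q^(x(x-1)/2) = 1 forces q^x >= q / (32n)^2, so this probability
   is at least d = c / n^4.  Some cut thus separates a fraction d of any family
   of pairs; choosing cuts greedily leaves at most (1-d)^N 4^n < 1 pairs after
   N = O(n/d) = O(n^5) steps.  For p = 0 or 1, one of the two sizes is 1 and
   n + 1 cuts are enough. *)

Require Import Defs.
From HB Require Import structures.
From mathcomp Require Import all_boot all_order all_algebra.
From mathcomp Require Import all_classical all_reals all_analysis.
From mathcomp Require Import measurable_realfun.
From mathcomp Require Import ring lra.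

Import Order.TTheory GRing.Theory Num.Theory.
Import numFieldNormedType.Exports.

Local Open Scope ring_scope.

(** * Greedy covering by averaging *)

(** By double counting, the [mu]-average of the number of uncovered points hit by [u] is at least
    [d] times the number of uncovered points. Some [u] therefore hits that fraction, and adding it
    to [F] multiplies the bound by [1 - d]. *)
Lemma greedy_cover (R : realType) (T U : finType) (mu : U -> R)
    (r : U -> T -> bool) (d : R) (N : nat) :
  (forall u, 0 <= mu u) -> \sum_u mu u = 1 -> d <= 1 ->
  forall P : {set T}, (forall t, t \in P -> d <= \sum_(u | r u t) mu u) ->
  exists F : {set U}, (#|F| <= N)%N /\
    #|[set t in P | ~~ [exists u in F, r u t]]|%:R <= (1 - d) ^+ N * #|P|%:R.
Proof.
move=> mu0 mu1 d1 P dP; elim: N => [|N [F [FN FP]]].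
  exists finset.set0; rewrite cards0 expr0 mul1r; split=> //.
  by rewrite ler_nat subset_leq_card//; apply/fintype.subsetP => t; rewrite inE => /andP[].
set Q := [set t in P | _] in FP.
pose hit u := [set t in Q | r u t].
have dhit : \sum_u mu u * (d * #|Q|%:R - #|hit u|%:R) <= 0.
  under eq_bigr do rewrite mulrBr.
  rewrite sumrB -mulr_suml mu1 mul1r subr_le0.
  under eq_bigr => u _.
    rewrite -sum1_card natr_sum mulr_sumr.
    under eq_bigr do rewrite mulr1.
    rewrite (eq_bigl (fun t => (t \in Q) && r u t)); last first.
      by move=> t; rewrite inE.
    over.
  rewrite (exchange_big_dep (fun t => t \in Q)) /=; last by move=> ? ? _ /andP[].
  rewrite -sum1_card natr_sum mulr_sumr; apply: ler_sum => t tQ.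
  rewrite mulr1 (le_trans (dP t _))//; first by move: tQ; rewrite inE => /andP[].
  by rewrite le_eqVlt; apply/orP/or_introl/eqP/eq_bigl => u; rewrite tQ.
(* If every [u] fell short, [dhit] would be a sum of nonnegative terms that is at most 0, so all
   weights [mu u] would vanish, against total mass 1. *)
have [u hu] : exists u, d * #|Q|%:R <= #|hit u|%:R.
  apply/not_existsP => /= nhit.
  have pos u : 0 < d * #|Q|%:R - #|hit u|%:R.
    by rewrite subr_gt0 ltNge; apply/negP/nhit.
  have : \sum_u mu u * (d * #|Q|%:R - #|hit u|%:R) == 0.
    by rewrite eq_le dhit sumr_ge0// => u _; rewrite mulr_ge0// ltW.
  rewrite psumr_eq0 => [/allP mu00|u _]; last by rewrite mulr_ge0// ltW.
  move: mu1; rewrite big1 => [/eqP|u _]; first by rewrite eq_sym oner_eq0.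
  have /eqP/eqP := mu00 u (mem_index_enum u).
  by rewrite mulf_eq0 (gt_eqF (pos u)) orbF => /eqP.
exists (u |: F); split.
  by rewrite (leq_trans (leq_card_setU _ _))// cards1 add1n ltnS.
apply: (@le_trans _ _ (#|Q :\: hit u|%:R)).
  rewrite ler_nat subset_leq_card//; apply/fintype.subsetP => t.
  rewrite !inE => /andP[tP] /existsPn nt; rewrite tP /=.
  have := nt u; rewrite !inE eqxx /= => /negPf ->; rewrite andbF /=.
  apply/existsPn => v; have := nt v; rewrite !inE.
  by case: (v \in F); rewrite //= orbT.
have hQ : hit u \subset Q by apply/fintype.subsetP => t; rewrite inE => /andP[].
rewrite cardsD (finset.setIidPr hQ) natrB ?subset_leq_card//.
rewrite exprS -mulrA (le_trans _ (ler_wpM2l _ FP)) ?subr_ge0//.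
by rewrite mulrBl mul1r lerB.
Qed.

(** * Random cuts *)

(** Expand a product over the vertices of (weight inside [U]) + (weight outside [U]), where
    forbidden choices get weight 0. A vertex outside both sets contributes [p + (1 - p) = 1]. *)
Lemma sum_prod_cuts (R : realType) (T : finType) (p : R) (A B : {set T}) :
  [disjoint A & B] ->
  \sum_(U : {set T} | (A \subset U) && (B \subset ~: U))
    \prod_(v : T) (if v \in U then p else 1 - p) =
  p ^+ #|A| * (1 - p) ^+ #|B|.
Proof.
move=> AB.
transitivity (\prod_(v : T) ((if v \in B then 0 else p) +
                             (if v \in A then 0 else 1 - p))).
  rewrite [RHS]bigA_distr big_mkcond; apply: eq_bigr => U _.
  case: ifPn => [/andP[AU BU]|].
    apply: eq_bigr => v _; case: ifPn => vU.
      by case: ifPn => // /(fintype.subsetP BU); rewrite inE vU.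
    by case: ifPn => // /(fintype.subsetP AU); rewrite (negPf vU).
  rewrite negb_and => /orP[] /fintype.subsetPn[v].
    by move=> vA vU; rewrite (bigD1 v)//= (negPf vU) vA mul0r.
  by rewrite inE negbK => vB vU; rewrite (bigD1 v)//= vU vB mul0r.
rewrite -!prodr_const [in RHS]big_mkcond [X in _ * X]big_mkcond -big_split /=.
apply: eq_bigr => v _; case: (boolP (v \in A)) => vA.
  by rewrite (disjointFr AB vA) addr0 mulr1.
by case: ifP => _; rewrite ?add0r ?mul1r// addrC subrK.
Qed.

Lemma gnp_prob_predT (R : realType) (n : nat) (p : R) (P : pred (graph n)) :
  (forall G, P G) -> gnp_prob p P = 1.
Proof.
move=> PT; rewrite /gnp_prob (eq_bigl xpredT) => [|G]; last by rewrite PT.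
transitivity (\prod_(e : vpair n) (p + (1 - p))).
  by rewrite bigA_distr.
by rewrite big1// => e _; rewrite addrC subrK.
Qed.

(** After [N] greedy choices fewer than [expR (3 * n - d * N) < 1] pairs, up to equality in the
    first bound, remain unseparated, hence none. *)
Lemma small_complete_separator (R : realType) (n N : nat) (G : graph n)
    (p a b d : R) :
  0 <= p <= 1 -> 0 <= d <= 1 ->
  (forall A B : {set 'I_n}, #|A|%:R <= a -> #|B|%:R <= b ->
    d <= p ^+ #|A| * (1 - p) ^+ #|B|) ->
  3 * n%:R < d * N%:R ->
  exists F : {set Defs.cut n}, complete_separator G a b F /\ (#|F| <= N)%N.
Proof.
move=> /andP[p0 p1] /andP[d0 d1] dAB nN.
pose mu (U : {set 'I_n}) := \prod_(v : 'I_n) (if v \in U then p else 1 - p).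
pose r (U : {set 'I_n}) (AB : {set 'I_n} * {set 'I_n}) := separates U AB.1 AB.2.
pose P := [set AB : {set 'I_n} * {set 'I_n} |
  [&& [disjoint AB.1 & AB.2], #|AB.1|%:R <= a & #|AB.2|%:R <= b]]%SET.
have mu0 U : 0 <= mu U.
  by apply: prodr_ge0 => v _; case: ifP; rewrite ?subr_ge0.
have mu1 : \sum_U mu U = 1.
  transitivity (p ^+ #|@finset.set0 'I_n| * (1 - p) ^+ #|@finset.set0 'I_n|).
    rewrite -sum_prod_cuts ?finset.disjoints_subset ?finset.sub0set//.
    by apply: eq_bigl => U; rewrite !finset.sub0set.
  by rewrite !cards0 !expr0 mulr1.
have dP t : t \in P -> d <= \sum_(u | r u t) mu u.
  rewrite inE => /and3P[tD ta tb].
  by rewrite /r /separates sum_prod_cuts// dAB.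
have [F [FN FP]] := greedy_cover _ _ _ _ _ _ N mu0 mu1 d1 _ dP.
exists F; split=> //.
have : #|[set t in P | ~~ [exists u in F, r u t]]%SET|%:R < 1 :> R.
  apply: (le_lt_trans FP).
  apply: (@le_lt_trans _ _ (expR (- d) ^+ N * expR 3 ^+ n)).
    apply: ler_pM => //; first by rewrite exprn_ge0 ?subr_ge0.
      by rewrite lerXn2r ?nnegrE ?expR_ge0 ?subr_ge0// expR_ge1Dx.
    (* There are at most [4 ^+ n] pairs of subsets, and [4 = 1 + 3 <= expR 3]; this is the source of
       the factor 3 in the hypothesis on [N]. *)
    apply: (@le_trans _ _ (4 ^+ n)).
      rewrite -natrX ler_nat (leq_trans (max_card _))//.
      rewrite card_prod -cardsT -powersetT card_powerset cardsT card_ord.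
      by rewrite -expnMn.
    rewrite lerXn2r ?nnegrE ?expR_ge0//.
    by rewrite (le_trans _ (expR_ge1Dx _))//; lra.
  rewrite -!expRM_natl -expRD -[ltRHS]expR0 ltr_expR.
  by move: nN; rewrite mulrN; lra.
rewrite (ltr_nat _ _ 1) ltnS leqn0 cards_eq0 => /eqP Q0.
apply/forallP => A; apply/forallP => B; apply/implyP => AB.
apply: contraT => nF.
have : (A, B) \in [set t in P | ~~ [exists u in F, r u t]]%SET.
  by rewrite !inE AB.
by rewrite Q0 inE.
Qed.

(** * Bounds on the threshold size *)

Lemma bernoulli_ineq (R : realDomainType) (s : R) (n : nat) : s <= 1 ->
  1 - n%:R * s <= (1 - s) ^+ n.
Proof.
move=> s1; elim: n => [|n IH]; first by rewrite mul0r subr0 expr0.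
rewrite exprS; apply: le_trans (ler_wpM2l _ IH); last by rewrite subr_ge0.
by rewrite -natr1; have := ler0n R n; nra.
Qed.

(** Restrict the integral to an interval of length [1/(4n)] starting at [1/(4n)], on which the
    integrand is at least [(4n)^(-x) / 2]. *)
Lemma beta_integral_ge (R : realType) (n : nat) (x : R) :
  (0 < n)%N -> 0 < x <= n%:R ->
  ((4 * n%:R) `^ x * (8 * n%:R))^-1 <=
  \int[@lebesgue_measure R]_(t in `[0, 1]%classic)
     (t `^ x * (1 - t) `^ (n%:R - x)).
Proof.
move=> n0 /andP[x0 xn]; pose f (t : R) := t `^ x * (1 - t) `^ (n%:R - x).
pose m : R := n%:R; have m1 : 1 <= m by rewrite ler1n.
have m0 : 0 < m by lra.
(* On [1/(4n), 1/(2n)], Bernoulli's inequality gives (1 - t)^n >= 1/2. *)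
pose u := (4 * m)^-1; pose v := (2 * m)^-1.
have u0 : 0 < u by rewrite invr_gt0; lra.
have uv : v = 2 * u by rewrite /u /v; field; lra.
have mu4 : m * u = 4^-1 by rewrite /u; field; lra.
have v1 : v <= 2^-1 by rewrite uv; nra.
have f0 t : 0 <= f t by rewrite mulr_ge0// powR_ge0.
have mf : measurable_fun setT f.
  apply: measurable_funM; first exact: measurable_powR.
  apply: (measurableT_comp (measurable_powR _)).
  exact: measurable_funB.
have f1 t : t \in `[0, 1] -> f t <= 1.
  rewrite in_itv /= => /andP[t0 t1].
  have one y : 1 `^ y = 1 :> R by rewrite powR1.
  rewrite mulr_ile1 ?powR_ge0//.
    by rewrite -[leRHS](one x) ge0_ler_powR ?nnegrE// ltW.
  by rewrite -[leRHS](one (n%:R - x)) ge0_ler_powR ?nnegrE; lra.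
have intf : (@lebesgue_measure R).-integrable `[0, 1]%classic (EFin \o f).
  apply: measurable_bounded_integrable => //=.
  - by rewrite lebesgue_measure_itv /= lte_fin ltr01 -EFinB ltry.
  - exact: measurable_funS mf.
  - exists 1; split; first exact: num_real.
    move=> M M1 t tI /=; rewrite ger0_norm//.
    by rewrite (le_trans _ (ltW M1)) ?f1.
have sub : (`[u, v] `<=` `[0, 1])%classic.
  move=> t /=; rewrite !in_itv /= => /andP[ut tv]; lra.
apply: (@le_trans _ _ (\int[@lebesgue_measure R]_(t in `[u, v]%classic) f t)).
  apply: (@le_trans _ _ (\int[@lebesgue_measure R]_(t in `[u, v]%classic)
     (u `^ x * 2^-1))).
    rewrite Rintegral_cst//= lebesgue_measure_itv /= lte_fin.
    rewrite ifT; last by lra.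
    have -> : u `^ x = ((4 * m) `^ x)^-1.
      by rewrite -powR_inv1 ?powR_ge0// powRAC powR_inv1//; lra.
    rewrite -EFinB /= invfM -mulrA ler_wpM2l ?invr_ge0 ?powR_ge0//.
    have -> : v - u = u by lra.
    by rewrite le_eqVlt; apply/orP/or_introl/eqP; rewrite /u -/m; field; lra.
  apply: le_Rintegral => //.
  - apply: measurable_bounded_integrable => //=.
      by rewrite lebesgue_measure_itv /= lte_fin; case: ifP => _; rewrite -?EFinB ltry.
    exact: bounded_cst.
  - exact: integrableS intf.
  - move=> t /=; rewrite in_itv /= => /andP[ut tv].
    rewrite ler_pM ?powR_ge0//.
      by rewrite ge0_ler_powR ?nnegrE; lra.
    have t1 : 0 < 1 - t <= 1 by lra.
    have le_n : n%:R - x <= n%:R by lra.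
    apply: le_trans (ger_powR t1 le_n).
    rewrite powR_mulrn; last lra.
    apply: le_trans (bernoulli_ineq _ _ _ _); last lra.
    by rewrite -/m; nra.
rewrite /Rintegral fine_le//.
- by apply: integrable_fin_num => //; exact: integrableS intf.
- exact: integrable_fin_num.
- apply: ge0_subset_integral => //=.
    exact/measurable_EFinP/measurable_funTS.
  by move=> t _; rewrite lee_fin f0.
Qed.

(** Inverting the bound on the beta integral leaves a factor [8n/(n+1)], which is at most 8. *)
Lemma rbinom_le (R : realType) (n : nat) (x : R) :
  (0 < n)%N -> 0 < x <= n%:R -> rbinom n x <= 8 * (4 * n%:R) `^ x.
Proof.
move=> n0 xn; have In := beta_integral_ge _ _ _ n0 xn.
have m1 : 1 <= n%:R :> R by rewrite ler1n.
have pow0 : 0 < (4 * n%:R) `^ x :> R by rewrite powR_gt0//; lra.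
rewrite /rbinom; set J := Rintegral _ _ _ in In *.
have J0 : 0 < J by apply: lt_le_trans In; rewrite invr_gt0 mulr_gt0//; lra.
rewrite -[leLHS]mul1r ler_pdivrMr ?mulr_gt0 ?ltr0n//.
have : 8 * (4 * n%:R) `^ x * (n.+1%:R * ((4 * n%:R) `^ x * (8 * n%:R))^-1) <=
    8 * (4 * n%:R) `^ x * (n.+1%:R * J).
  by rewrite ler_wpM2l ?mulr_ge0 ?(ltW pow0)// ler_wpM2l.
apply: le_trans; rewrite -(natr1 n).
have -> : 8 * (4 * n%:R) `^ x * ((n%:R + 1) * ((4 * n%:R) `^ x * (8 * n%:R))^-1) =
    (n%:R + 1) / n%:R :> R.
  by field; rewrite !gt_eqF//; lra.
by rewrite ler_pdivlMr; lra.
Qed.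

Lemma powR_threshold_size_ge (R : realType) (n : nat) (q : R) :
  (0 < n)%N -> 0 < q <= 1 ->
  q / (1024 * n%:R ^+ 2) <= q `^ threshold_size n q.
Proof.
move=> n0 /andP[q0 q1].
have m1 : 1 <= n%:R :> R by rewrite ler1n.
set m : R := n%:R in m1 *.
have q01 : 0 < q <= 1 by rewrite q0.
have D1 : 1 <= 1024 * m ^+ 2 by nra.
have small : q / (1024 * m ^+ 2) <= q.
  by rewrite ler_pdivrMr ?(lt_le_trans ltr01)// ler_peMr// ltW.
(* Without a root the default size 1 gives [q] itself, which is large enough. *)
rewrite /threshold_size; case: xgetP => [x _ [xn Ex]|_]; last first.
  by rewrite powRr1// ltW.
have [x1|x1] := leP x 1.
  by apply: (le_trans small); have := ger_powR q01 x1; rewrite powRr1// ltW.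
have /andP[x0 _] := xn.
(* Chosen so that [y^x] is [8^x (4n)^x q^(x(x-1)/2)]. As [x > 1] gives [8 <= 8^x], this dominates
   the expectation, which is 1. Hence [y >= 1], and squaring bounds [q^(x-1)] below by
   [1/(1024 n^2)]. *)
pose y := 32 * m * q `^ ((x - 1) / 2).
have y0 : 0 <= y by rewrite !mulr_ge0 ?powR_ge0//; lra.
have y1 : 1 <= y.
  rewrite leNgt; apply/negP => ylt.
  have : y `^ x < 1.
    by have := gt0_ltr_powR x0 y0 ler01 ylt; rewrite powR1.
  apply/negP; rewrite -leNgt -Ex /expected_homogeneous.
  have -> : y `^ x = 8 `^ x * (4 * m) `^ x * q `^ (x * (x - 1) / 2).
    rewrite /y powRM ?powR_ge0//; last lra.
    rewrite -(@powRM _ 8); [|lra..].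
    by rewrite -powRrM; congr (_ `^ _ * _ `^ _); lra.
  rewrite ler_wpM2r ?powR_ge0// (le_trans (rbinom_le _ _ _ n0 xn))//.
  by rewrite ler_wpM2r ?powR_ge0// le1r_powR; lra.
have -> : q `^ x = q * (q `^ ((x - 1) / 2)) ^+ 2.
  rewrite -powR_mulrn ?powR_ge0// -powRrM -[X in X * _](@powRr1 _ q) ?ltW//.
  by rewrite -powRD ?(gt_eqF q0) ?implybT//; congr (_ `^ _); field.
rewrite ler_wpM2l ?(ltW q0)// -[leLHS]mul1r ler_pdivrMr; last by nra.
have -> : (q `^ ((x - 1) / 2)) ^+ 2 * (1024 * m ^+ 2) = y ^+ 2.
  by rewrite /y; ring.
by rewrite exprn_ege1.
Qed.

(** * The extreme probabilities 0 and 1 *)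

(** A power of 0 with nonzero exponent vanishes, so a positive root needs [x(x-1)/2 = 0], that is
    [x = 1], which is also the default. *)
Lemma threshold_size0 (R : realType) (n : nat) : threshold_size n (0 : R) = 1.
Proof.
rewrite /threshold_size; case: xgetP => // x _ [/andP[x0 _]].
rewrite /expected_homogeneous; have [/eqP|xx] := eqVneq (x * (x - 1) / 2) 0.
  rewrite !mulf_eq0 (gt_eqF x0) invr_eq0 pnatr_eq0 orbF /= subr_eq0.
  by move=> /eqP.
by rewrite powR0// mulr0 => /esym/eqP; rewrite oner_eq0.
Qed.

Lemma complete_separatorC (R : realType) (n : nat) (G : graph n) (a b : R)
    (F : {set Defs.cut n}) :
  complete_separator G a b F ->
  complete_separator G b a [set ~: U | U in F]%SET.
Proof.
move=> /forallP FP; apply/forallP => A; apply/forallP => B.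
apply/implyP => /and3P[AB Ab Ba].
have /forallP/(_ A)/implyP := FP B.
rewrite disjoint_sym AB Ab Ba => /(_ isT)/existsP[U /andP[UF /andP[BU AU]]].
apply/existsP; exists (~: U)%SET.
by rewrite imset_f// /separates AU finset.setCK.
Qed.

(** A set [A] with at most one vertex serves as its own cut. *)
Lemma singleton_complete_separator (R : realType) (n : nat) (G : graph n)
    (b : R) :
  exists F : {set Defs.cut n}, complete_separator G 1 b F /\ (#|F| <= n.+1)%N.
Proof.
exists (finset.set0 |: [set [set v] | v : 'I_n])%SET; split; last first.
  rewrite (leq_trans (leq_card_setU _ _))// cards1 add1n ltnS.
  by rewrite (leq_trans (leq_imset_card _ _))// card_ord.
apply/forallP => A; apply/forallP => B; apply/implyP => /and3P[AB + _].
rewrite (ler_nat _ _ 1) => A1; apply/existsP; exists A.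
rewrite /separates fintype.subxx -finset.disjoints_subset disjoint_sym AB !andbT.
rewrite !inE; have [//|/set0Pn[v vA]] := eqVneq A finset.set0.
apply/imsetP; exists v => //; apply/eqP.
by rewrite eq_sym eqEcard finset.sub1set vA cards1.
Qed.

(** * Assembling the bounds *)

Lemma complete_separator_pow5 (R : realType) (p : R) : 0 <= p <= 1 ->
  exists K : R, forall (n : nat) (G : graph n), (0 < n)%N ->
    exists F : {set Defs.cut n},
      complete_separator G (clique_number n p) (independence_number n p) F /\
      #|F|%:R <= K * n%:R ^+ 5.
Proof.
have pow5 n : (0 < n)%N -> n.+1%:R <= 2 * n%:R ^+ 5 :> R.
  move=> n0; rewrite -natrX -natrM ler_nat (@leq_trans (2 * n))//.
    by rewrite mul2n -addnn -addn1 leq_add2l.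
  by rewrite leq_mul2l -[leqLHS]expn1 leq_pexp2l.
move=> /andP[]; rewrite le_eqVlt => /predU1P[<- _|p0].
  exists 2 => n G n0; rewrite /clique_number threshold_size0.
  have [F [FG Fn]] := singleton_complete_separator _ _ G (independence_number n (0 : R)).
  by exists F; split=> //; apply: le_trans (pow5 n n0); rewrite ler_nat.
(* Here the independence number is 1, and complementing the cuts exchanges the two sides. *)
rewrite le_eqVlt => /predU1P[->|p1].
  exists 2 => n G n0; rewrite /independence_number subrr threshold_size0.
  have [F [FG Fn]] := singleton_complete_separator _ _ G (clique_number n (1 : R)).
  exists [set ~: U | U in F]%SET; split; first exact: complete_separatorC.
  apply: le_trans (pow5 n n0).
  by rewrite ler_nat (leq_trans (leq_imset_card _ _)).
(* The constant 1024 is abstracted because simplification would expand its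
   square in unary. *)
have [k k1 kP] : exists2 k : R, 1 <= k & forall n (q : R), (0 < n)%N ->
    0 < q <= 1 -> q / (k * n%:R ^+ 2) <= q `^ threshold_size n q.
  by exists 1024 => [|n q]; [rewrite ler1n | exact: powR_threshold_size_ge].
have k0 : 0 < k by lra.
pose c := p * (1 - p) / k ^+ 2.
have c0 : 0 < c by rewrite divr_gt0 ?exprn_gt0// mulr_gt0// subr_gt0.
(* With [d = c / n^4], the number of cuts is at most [3n/d + 1 = (3/c) n^5 + 1], and the last 1 is
   absorbed by [n^5]. *)
exists (3 / c + 1) => n G n0.
have m1 : 1 <= n%:R :> R by rewrite ler1n.
have m0 : 0 < n%:R :> R by lra.
pose d := c / n%:R ^+ 4.
have d0 : 0 < d by rewrite divr_gt0 ?exprn_gt0.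
have dE : d = p / (k * n%:R ^+ 2) * ((1 - p) / (k * n%:R ^+ 2)).
  by rewrite /d /c; field; rewrite !gt_eqF.
have p01 : 0 < p <= 1 by lra.
have q01 : 0 < 1 - p <= 1 by lra.
have dAB (A B : {set 'I_n}) : #|A|%:R <= clique_number n p ->
    #|B|%:R <= independence_number n p -> d <= p ^+ #|A| * (1 - p) ^+ #|B|.
  have [p_ge0 q_ge0] : 0 <= p /\ 0 <= 1 - p by lra.
  move=> Aw Ba; rewrite dE -(powR_mulrn #|A| p_ge0) -(powR_mulrn #|B| q_ge0).
  apply: ler_pM; rewrite ?divr_ge0 ?mulr_ge0 ?exprn_ge0//; try lra.
    exact: le_trans (kP _ _ n0 p01) (ger_powR p01 Aw).
  exact: le_trans (kP _ _ n0 q01) (ger_powR q01 Ba).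
have d1 : d <= 1.
  have n4 : 1 <= n%:R ^+ 4 :> R by rewrite exprn_ege1.
  rewrite ler_pdivrMr ?exprn_gt0// mul1r (le_trans _ n4)//.
  rewrite ler_pdivrMr ?exprn_gt0// mul1r (le_trans (_ : _ <= 1)) ?exprn_ege1 ?ler1n//.
  by nra.
pose N := (Num.truncn (3 * n%:R / d)).+1.
have dN : 3 * n%:R < d * N%:R.
  by rewrite [d * _]mulrC -ltr_pdivrMr// truncnS_gt.
have [||F [FG FN]] := small_complete_separator _ n N G p _ _ d _ _ dAB dN.
- by lra.
- by rewrite ltW.
exists F; split=> //.
apply: (@le_trans _ _ N%:R); first by rewrite ler_nat.
have x0 : 0 <= 3 * n%:R / d by rewrite divr_ge0 ?ltW// mulr_gt0.
rewrite /N -[leLHS]natr1 [leRHS]mulrDl mul1r lerD//; last by rewrite exprn_ege1.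
rewrite (@le_trans _ _ (3 * n%:R / d)) ?truncn_le//.
by rewrite le_eqVlt; apply/orP/or_introl/eqP; rewrite /d; field; rewrite !gt_eqF.
Qed.

Local Open Scope classical_set_scope.

Theorem theorem4 (R : realType) :
  exists2 C : R, 0 < C &
    forall p : R, 0 <= p <= 1 ->
      gnp_prob p (@admits_complete_separator R n
                    (clique_number n p) (independence_number n p)
                    (C * n%:R ^+ 7)) @[n --> \oo] --> (1 : R).
Proof.
(* Any positive [C] would be reachable this way; with [C = 1], once [n >= K] and [n >= 1], one has
   [K n^5 <= n^7]. *)
exists 1 => // p p01.
have [K KP] := complete_separator_pow5 _ _ p01.
(* The probability is exactly 1 for all large [n], since every graph then has such a separator. *)
apply: cvg_near_cst; near=> n.
have n1 : 1 <= n%:R :> R by rewrite ler1n; near: n; exact: nbhs_infty_gt.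
have Kn : K <= n%:R by near: n; exact: nbhs_infty_ger.
apply: gnp_prob_predT => G.
have [|F [FG FK]] := KP n G; first by rewrite -(ltr_nat R); lra.
apply/existsP; exists F; rewrite FG mul1r (le_trans FK)//.
rewrite (_ : 7 = 2 + 5)%N// exprD ler_wpM2r ?exprn_ge0//; nra.
Unshelve. all: by end_near.
Qed.
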